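(* For every real $Q\ge 4$ there is a (dyadic) weight $w\in A_1$ on $\mathbb R$ with $[w]_{A_1}=Q$ such that the constant in the weak type inequality for the dyadic martingale transform in $L^1(w)$ is at least $\frac1{515}Q(\log Q)^{1/3}$. That is, if $C$ is a constant such that $$ \frac1{|I|}\,\sup_{\varepsilon}\, w\Big(\Big\{t\in I:\ \sum_{J\in\mathcal D(I)}\varepsilon_J\,(\varphi,h_J)\,h_J(t)\ge\lambda\Big\}\Big)\ \le\ C\,\frac{\langle|\varphi|w\rangle_I}{\lambda} $$ for all dyadic intervals $I$, all $\lambda>0$ and all $\varphi\in L^1(I,w\,dt)$ with $\operatorname{supp}\varphi\subset I$ (the supremum being over all families $\varepsilon=\{\varepsilon_J\}$ with $|\varepsilon_J|\le1$), then $$ C\ \ge\ \frac1{515}\,Q(\log Q)^{1/3}. $$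
   Context: $\mathcal D=\bigcup_k\mathcal D_k$, $\mathcal D_k=\{[m2^{-k},(m+1)2^{-k}):m\in\mathbb Z\}$, is the standard dyadic lattice on $\mathbb R$, and $\mathcal D(I)$ is the set of dyadic subintervals of $I$ (including $I$). $J^-$ and $J^+$ are the left and right halves of $J$. $h_J$ is the Haar function equal to $|J|^{-1/2}$ on $J^+$, $-|J|^{-1/2}$ on $J^-$ and $0$ off $J$. $(\cdot,\cdot)$ is the $L^2(dt)$ scalar product, $\langle f\rangle_I=\frac1{|I|}\int_I f\,dt$, and $w(S)=\int_S w\,dt$. A positive locally integrable function $w$ is a (dyadic) $A_1$ weight if $[w]_{A_1}:=\sup_{J\in\mathcal D}\frac{\langle w\rangle_J}{\inf_J w}<\infty$, where $\inf$ is the essential infimum. The Haar sums are understood, as throughout the paper, to have a finite (but unspecified) number of terms, i.e. only finitely many $\varepsilon_J$ are nonzero. $\log$ is the natural logarithm. *)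

(* Defs.v *)
From HB Require Import structures.
From mathcomp Require Import all_boot all_order all_algebra.
From mathcomp Require Import all_classical all_reals all_analysis.
From mathcomp Require Import ess_sup_inf.

Set Implicit Arguments.
Unset Strict Implicit.
Unset Printing Implicit Defensive.

Import Order.TTheory GRing.Theory Num.Theory.
Import numFieldNormedType.Exports.

Local Open Scope classical_set_scope.
Local Open Scope ring_scope.

(* The pair (k, m) encodes the dyadic interval [m 2^-k, (m+1) 2^-k); this
   encoding of the lattice D is bijective. *)
Definition dyadic : Type := (int * int)%type.

Definition dlen (R : realType) (J : dyadic) : R := 2%:R ^ (- J.1).

Definition dint (R : realType) (J : dyadic) : set R :=
  [set` `[J.2%:~R * dlen R J, (J.2 + 1)%:~R * dlen R J[ ].
Arguments dint : clear implicits.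

Lemma measurable_dint (R : realType) (J : dyadic) : measurable (dint R J).
Proof. exact: measurable_itv. Qed.
Arguments measurable_dint : clear implicits.

Definition dleft (J : dyadic) : dyadic := (J.1 + 1, 2 * J.2).
Definition dright (J : dyadic) : dyadic := (J.1 + 1, 2 * J.2 + 1).

Definition dsub (R : realType) (I : dyadic) : set dyadic :=
  [set J | dint R J `<=` dint R I].

Definition haar (R : realType) (J : dyadic) (t : R) : R :=
  (Num.sqrt (dlen R J))^-1 *
  (\1_(dint R (dright J)) t - \1_(dint R (dleft J)) t).

Definition scal (R : realType) (f g : R -> R) : R :=
  \int[lebesgue_measure]_(t in setT) (f t * g t).

Definition mean (R : realType) (J : dyadic) (f : R -> R) : \bar R :=
  ((dlen R J)^-1%:E * \int[lebesgue_measure]_(t in dint R J) (f t)%:E)%E.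

Definition wmeas (R : realType) (w : R -> R) (S : set R) : \bar R :=
  (\int[lebesgue_measure]_(t in S) (w t)%:E)%E.

Definition weight (R : realType) (w : R -> R) : Prop :=
  (forall t, 0 < w t) /\ locally_integrable setT w.

Definition einf (R : realType) (J : dyadic) (w : R -> R) : \bar R :=
  ess_inf (mrestr lebesgue_measure (measurable_dint R J)) (EFin \o w).

(* In \bar R, 0^-1 = +oo, so a weight whose essential infimum vanishes on some
   dyadic interval has A1 constant +oo. *)
Definition A1const (R : realType) (w : R -> R) : \bar R :=
  ereal_sup [set (mean J w / einf J w)%E | J in [set: dyadic]].

Definition A1 (R : realType) (w : R -> R) : Prop :=
  weight w /\ (A1const w < +oo)%E.

Definition admissible (R : realType) (eps : dyadic -> R) : Prop :=
  finite_set [set J | eps J != 0] /\ (forall J, `|eps J| <= 1).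

(* fsbig sums are 0 for infinitely supported summands; this never occurs when
   eps is admissible. *)
Definition martingale_transform (R : realType) (eps : dyadic -> R)
    (I : dyadic) (phi : R -> R) (t : R) : R :=
  \sum_(J \in dsub R I) (eps J * scal phi (haar J) * haar J t).

(* The support is not the topological one: I is half open. When w is A1, such a
   phi is also dt-integrable, since ess inf_I w > 0. *)
Definition L1supp (R : realType) (w : R -> R) (I : dyadic) (phi : R -> R) :
    Prop :=
  [/\ measurable_fun setT phi,
      lebesgue_measure.-integrable (dint R I) (EFin \o (fun t => phi t * w t))
    & forall t, ~ dint R I t -> phi t = 0].

Definition weak_type_bound (R : realType) (w : R -> R) (C : R) : Prop :=
  forall (I : dyadic) (lambda : R) (phi : R -> R),
    0 < lambda -> L1supp w I phi ->
    ((dlen R I)^-1%:E *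
       ereal_sup [set wmeas w
                        [set t | dint R I t /\
                          (lambda <= martingale_transform eps I phi t)%R]
                 | eps in admissible (R:=R)]
     <= C%:E * (mean I (fun t => `|phi t| * w t)%R / lambda%:E))%E.

(* Main.v *)
Require Import Defs.
From mathcomp Require Import all_boot all_order all_algebra.
From mathcomp Require Import all_classical all_reals all_analysis.
From mathcomp Require Import measurable_realfun ess_sup_inf ring lra.

(** Write E_w for the mean with respect to the weight. If phi is a martingale
    whose transform is to be large on a set of large weight, one pays for |phi|
    times the weight at the end, and this may be arranged on pieces where the weight
    is about 1 / Q of its usual size. What is gained is the drift of the
    transform under E_w: a Haar term whose sign follows the Haar term of the weight
    contributes the product of the two jumps.

    The construction makes this drift large. Let phi start from a small value and
    double repeatedly, returning to its base value with probability 1/2 each time.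
    The k-th jump has size 2 ^ k and is made with probability 2 ^- k, so that each
    doubling contributes the same drift, provided that the weight makes a jump of a
    fixed proportion at each step. The weight does so without leaving a bounded
    range if it alternately goes down and up along the doubling path, with the sign
    of the transform following it ([doubling], [mass_doubling]). Thus 2 * J
    doublings give a drift of order J, while the piece where phi has become large
    carries almost no weight.

    Such a level is repeated N times ([levels]). To restore the value of phi before
    each level, half of the interval is given a weight about 1 / Q of the mean and
    phi = 0; phi and the weight double on the other half, and only a fraction of
    order 1 / Q of the total weight is lost. Hence N may be of order Q. The
    increments of the levels are identically distributed under E_w with mean J / 3
    and second moment of order 4 ^ J, so by Chebyshev's inequality the transform
    exceeds N * J / 6 on half of the weight if 4 ^ J <= N and J >= 12
    ([mass_levels]), whereas the norm of phi stays comparable to the mean of the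
    weight ([cost_levels]). With J of order ln Q the weak type constant is at least
    a multiple of Q * ln Q ([weight_of_levels], [level_parameters]), which exceeds
    the required bound once ln Q > 64. For smaller Q a weight with two values
    gives Q - 1/2 ([weight_of_two_halves]).

    All of this concerns finite binary trees. Their realization on the line
    ([A1tree_realized]) shows that the recursively computed quantities are the
    integrals in question ([integral_stepf], [integral_mass], [transform_tree]) and
    that the A1 condition at the nodes of a tree gives it on all dyadic intervals
    ([A1on_stepf], [A1on_extend]). *)

Import Order.TTheory GRing.Theory Num.Theory.
Local Open Scope classical_set_scope.
Local Open Scope ring_scope.

Set Implicit Arguments.
Unset Strict Implicit.
Unset Printing Implicit Defensive.

(** * Weights and test functions on binary trees *)

(** Two dyadic step functions on a common interval, together with a martingale
    transform: [Leaf w f] stands for constant values [w] of the weight and [f] of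
    the test function, [Node e l r] for a split into halves at which the transform
    multiplies the Haar term by [e]. *)
Inductive tree (R : Type) :=
| Leaf of R & R
| Node of R & tree R & tree R.

Section Trees.
Context {R : realType}.
Implicit Types (T l r : tree R) (c e f lam s w x z Q : R).

Fixpoint avg (g : R -> R -> R) T : R :=
  match T with
  | Leaf w f => g w f
  | Node _ l r => (avg g l + avg g r) / 2
  end.

Definition wavg := avg (fun w _ => w).
Definition favg := avg (fun _ f => f).
Definition cost := avg (fun w f => `|f| * w).

(** The Haar term of a step function at a node takes the values plus and minus
    half the difference of its averages over the right and the left half. *)
Definition incr e l r : R := e * ((favg r - favg l) / 2).

(** The normalized weight of the set where the transform, started at [z] at the
    root, ends at or above [lam]. *)
Fixpoint mass lam T z : R :=
  match T with
  | Leaf w _ => if lam <= z then w else 0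
  | Node e l r => (mass lam l (z - incr e l r) + mass lam r (z + incr e l r)) / 2
  end.

Fixpoint wge c T : Prop :=
  match T with
  | Leaf w _ => c <= w
  | Node _ l r => wge c l /\ wge c r
  end.

(** Asking at every node that all leaves below be at least the mean divided by
    [Q] is the A1 condition with constant [Q] on the intervals of the tree, and
    is easier to propagate than a statement about minima. *)
Fixpoint A1tree Q T : Prop :=
  match T with
  | Leaf w _ => 0 < w
  | Node _ l r => [/\ A1tree Q l, A1tree Q r & wge (wavg T / Q) T]
  end.

Fixpoint signs_le1 T : Prop :=
  match T with
  | Leaf _ _ => True
  | Node e l r => [/\ `|e| <= 1, signs_le1 l & signs_le1 r]
  end.

Lemma wge_le c c' T : c <= c' -> wge c' T -> wge c T.
Proof.
move=> cc'; elim: T => [w f|e l IHl r IHr] /=; first exact: le_trans.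
by case=> /IHl ? /IHr ?.
Qed.

Section Doubling.
Variables (om : R) (cont : R -> tree R).

(** One level of the construction, entered with weight mean [c] and test mean
    [x + 1]. Each round consists of two splits: the test function either drops
    back to 1, and the construction goes on with [cont], or its excess over 1
    doubles. While the excess doubles twice, the weight mean goes from [c] to
    [5/6 c] and back to [c], and each time the sign of the Haar term is chosen so
    that the transform increases on the heavier half. After the last round all
    excess is put on a piece of weight [om * c], where it is cheap. Once
    [5/6] is chosen, the factors [7/6] and [2/3] are forced by the weight being a
    martingale; [2/3] is large enough for [cont] to receive at least the weight at
    which the level began. *)
Fixpoint doubling (j : nat) (x c : R) : tree R :=
  match j with
  | 0%N => Node 0 (Leaf (om * c) (2 * x + 1)) (cont ((2 - om) * c))
  | j'.+1 => Node (-1) (cont (7 / 6 * c))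
               (Node 1 (cont (2 / 3 * c)) (doubling j' (4 * x) c))
  end.

Lemma favg_doubling j x c : (forall s, favg (cont s) = 1) -> favg (doubling j x c) = x + 1.
Proof.
move=> flev.
elim: j x c => [|j IHj] x c; rewrite /favg /= -/favg ?flev ?IHj; lra.
Qed.

Lemma wavg_doubling j x c : (forall s, wavg (cont s) = s) -> wavg (doubling j x c) = c.
Proof.
move=> wlev.
elim: j x c => [|j IHj] x c; rewrite /wavg /= -/wavg ?wlev ?IHj; lra.
Qed.

(** The expensive values of the test function sit on the light pieces only: the
    excess [x] costs [om * c * x], however many times it is doubled before. *)
Lemma cost_doubling (kap : R) j x c :
    0 < om -> om <= 1 / 2 -> 0 <= kap -> 0 <= c -> 0 <= x ->
    (forall s, 0 <= s -> cost (cont s) <= kap * s) ->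
  cost (doubling j x c) <= kap * c + om * c * (2 * x + 1) / 2.
Proof.
move=> om0 om2 kap0 + + clev; elim: j x c => [|j IHj] x c c0 x0; rewrite /cost /= -/cost.
  have /clev : 0 <= (2 - om) * c by rewrite mulr_ge0//; lra.
  have : 0 <= om * kap * c by rewrite !mulr_ge0// ltW.
  move=> *; rewrite ger0_norm; lra.
have /clev : 0 <= 7 / 6 * c by lra.
have /clev : 0 <= 2 / 3 * c by lra.
have /(IHj _ _ c0) : 0 <= 4 * x by lra.
have : 0 <= om * c by rewrite mulr_ge0// ltW.
lra.
Qed.

(** If the distribution function of [cont] dominates a concave quadratic in the
    starting point, so does that of the whole level, because the weighted mean of
    a quadratic only involves the first two moments of the increment. With respect
    to the weight, the increment of the transform over [j] rounds has mean
    [j / 3 * x], since every round contributes the same amount: the increments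
    grow like [4 ^ j] and the probabilities decay like [4 ^- j]. The second
    moment is the coefficient of [x ^+ 2]; it solves
    [v (j + 1) = 7 / 3 + 2 / 3 * j + 4 * v j]. The loss [om / 2] accounts for the
    light piece. *)
Lemma mass_doubling lam (A B D : R) j x c z :
    0 < om -> om <= 1 / 2 -> 0 <= c -> A <= 1 -> 0 <= D ->
    (forall s, favg (cont s) = 1) ->
    (forall s y, 0 <= s -> s * (A - D * (y - B) ^+ 2) <= mass lam (cont s) y) ->
  c * (A - D * ((z - B) ^+ 2 + 2 * (z - B) * (j%:R / 3) * x
                + (23 / 27 * 4 ^+ j - 2 / 9 * j%:R - 23 / 27) * x ^+ 2) - om / 2)
    <= mass lam (doubling j x c) z.
Proof.
move=> om0 om2 c0 A1 D0 flev mlev; elim: j x z => [|j IHj] x z.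
  have /(mlev _ z) /= : 0 <= (2 - om) * c by rewrite mulr_ge0//; lra.
  rewrite /= /incr !mul0r subr0 addr0.
  have q1 : A - D * (z - B) ^+ 2 <= 1.
    by rewrite lerBlDr (le_trans A1)// lerDl mulr_ge0// sqr_ge0.
  have : 0 <= om * c * (1 - (A - D * (z - B) ^+ 2)).
    by rewrite mulr_ge0 ?mulr_ge0 ?(ltW om0)//; lra.
  have : 0 <= (if lam <= z then om * c else 0) by case: ifP => //; rewrite mulr_ge0// ltW.
  rewrite expr0 mulr0n; set m1 := mass _ _ _; set m2 := (if _ then _ else _).
  clearbody m1 m2 => ? ? ?; lra.
have f1 : incr (-1) (cont (7 / 6 * c)) (Node 1 (cont (2 / 3 * c)) (doubling j (4 * x) c)) = - x.
  by rewrite /incr {1}/favg /= -/favg !flev favg_doubling//; lra.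
have f2 : incr 1 (cont (2 / 3 * c)) (doubling j (4 * x) c) = 2 * x.
  by rewrite /incr !flev favg_doubling//; lra.
rewrite /= f1 f2.
have /(mlev _ (z - - x)) : 0 <= 7 / 6 * c by lra.
have /(mlev _ (z - x - 2 * x)) : 0 <= 2 / 3 * c by lra.
have := IHj (4 * x) (z - x + 2 * x).
have : 0 <= om * c by rewrite mulr_ge0// ltW.
rewrite -[j.+1%:R]natr1 (exprS 4).
lra.
Qed.

Lemma wge_doubling s j x c : 0 < om -> om <= 1 / 2 ->
    (forall s', 0 <= s' -> wge (om * s') (cont s')) ->
    0 <= s -> s <= 2 / 3 * c -> wge (om * s) (doubling j x c).
Proof.
move=> om0 om2 wlev s0; elim: j x => [|j IHj] x sc /=.
  split; first by rewrite ler_pM2l//; lra.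
  apply: wge_le (wlev _ _); last by rewrite mulr_ge0//; lra.
  rewrite ler_pM2l//.
  have : 0 <= (1 / 2 - om) * c by rewrite mulr_ge0//; lra.
  lra.
split; last split; last exact: IHj.
  by apply: wge_le (wlev _ _); rewrite ?ler_pM2l//; lra.
by apply: wge_le (wlev _ _); rewrite ?ler_pM2l//; lra.
Qed.

Lemma A1tree_doubling Q s j x c : 0 < Q -> om = 2 / Q -> om <= 1 / 2 ->
    (forall s', wavg (cont s') = s') ->
    (forall s', 0 <= s' -> wge (om * s') (cont s')) ->
    (forall s', 0 < s' -> A1tree Q (cont s')) ->
    0 < s -> s <= 2 / 3 * c -> c <= 2 * s -> A1tree Q (doubling j x c).
Proof.
move=> Q0 omE om2 wlev wglev Alev s0 sc cs.
have om0 : 0 < om by rewrite omE divr_gt0.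
have small u : u <= 2 * s -> u / Q <= om * s.
  by move=> us; rewrite omE mulrAC ler_pM2r ?invr_gt0.
have wg i y := @wge_doubling s i y c om0 om2 wglev (ltW s0) sc.
elim: j x => [|j IHj] x.
  have Ac : A1tree Q (cont ((2 - om) * c)) by apply: Alev; rewrite mulr_gt0//; lra.
  split=> //; first by rewrite /= mulr_gt0//; lra.
  apply: (@wge_le _ (om * s)); last exact: (wg 0).
  by rewrite (wavg_doubling 0 x c)// small.
have /= [w1 [w2 w3]] := wg j.+1 x.
split; first by apply: Alev; lra.
  split; [by apply: Alev; lra|exact: IHj|].
  apply: (@wge_le _ (om * s) (Node 1 _ _)); last by split.
  by rewrite small// /wavg /= -/wavg wlev wavg_doubling//; lra.
apply: (@wge_le _ (om * s) (doubling j.+1 x c)); last exact: wg.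
by rewrite (wavg_doubling j.+1 x c)// small.
Qed.

Lemma signs_doubling j x c : (forall s, signs_le1 (cont s)) -> signs_le1 (doubling j x c).
Proof.
move=> slev; elim: j x => [|j IHj] x /=; first by rewrite normr0.
by rewrite normrN normr1; split.
Qed.

End Doubling.

Section Levels.
Variables (om : R) (J : nat).

(** Each level begins by sending half of the interval to a light piece where the
    test function vanishes. This nearly doubles both means on the other half, so
    that the test mean, of which the doubling rounds use up one unit, is 1 again at
    the entrance of the next level, whereas hardly any weight is lost. *)
Fixpoint levels n s : tree R :=
  match n with
  | 0%N => Leaf s 1
  | n'.+1 => Node 0 (Leaf (om * s) 0) (doubling om (levels n') J 1 ((2 - om) * s))
  end.

Lemma favg_levels n s : favg (levels n s) = 1.
Proof.
elim: n s => [|n IHn] s //; rewrite /favg /= -/favg favg_doubling//; lra.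
Qed.

Lemma wavg_levels n s : wavg (levels n s) = s.
Proof.
elim: n s => [|n IHn] s //; rewrite /wavg /= -/wavg wavg_doubling//; lra.
Qed.

Lemma cost_levels n s : 0 < om -> om <= 1 / 2 -> 0 <= s ->
  cost (levels n s) <= (1 + 3 / 2 * om * n%:R) * s.
Proof.
move=> om0 om2; elim: n s => [|n IHn] s s0; first by rewrite /cost /= normr1; lra.
rewrite /cost /= normr0 -/cost -[n.+1%:R]natr1.
have k0 : 0 <= 1 + 3 / 2 * om * n%:R by rewrite addr_ge0// !mulr_ge0// ltW.
have c0 : 0 <= (2 - om) * s by rewrite mulr_ge0//; lra.
have := cost_doubling J om0 om2 k0 c0 ler01 IHn.
have : 0 <= om * s * (1 + 3 / 2 * om * n%:R + 3 / 2 * om) by rewrite !mulr_ge0//; lra.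
lra.
Qed.

(** Chebyshev's inequality for the transform under the weighted measure, by
    induction on the number of levels. After [n] levels the mean has grown by
    [n * (J / 3)] and the variance is at most [n * 4 ^+ J], while at most the
    fraction [om * n] of the weight has been lost on light pieces. The case of no
    level is the bound of an indicator from below by a quadratic. *)
Lemma mass_levels (M Lam : R) n s z : 0 < om -> om <= 1 / 2 -> 0 < Lam -> 0 <= s ->
  s * (1 - om * n%:R -
       ((z + n%:R * (J%:R / 3) - M) ^+ 2 + n%:R * 4 ^+ J) / Lam ^+ 2)
    <= mass (M - Lam) (levels n s) z.
Proof.
move=> om0 om2 L0; set D := (Lam ^+ 2)^-1.
have D0 : 0 <= D by rewrite invr_ge0 sqr_ge0.
elim: n s z => [|n IHn] s z s0.
  rewrite /= !mul0r !addr0 mulr0 subr0; case: ifPn => [_|].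
    by rewrite ler_piMr// lerBlDr lerDl mulr_ge0// sqr_ge0.
  rewrite -ltNge => zM; rewrite mulr_ge0_le0// subr_le0.
  rewrite ler_pdivlMr ?exprn_gt0// mul1r.
  by rewrite -[leRHS]sqrrN lerXn2r ?nnegrE; lra.
have c0 : 0 <= (2 - om) * s by rewrite mulr_ge0//; lra.
set A := 1 - om * n%:R - n%:R * 4 ^+ J * D.
set B := M - n%:R * (J%:R / 3).
have A1 : A <= 1.
  have : 0 <= om * n%:R by rewrite mulr_ge0// ltW.
  have : 0 <= n%:R * 4 ^+ J * D by rewrite !mulr_ge0// exprn_ge0.
  rewrite /A; lra.
have Hlev u y : 0 <= u ->
    u * (A - D * (y - B) ^+ 2) <= mass (M - Lam) (levels n u) y.
  by move=> /(IHn u y); apply: le_trans; rewrite /A /B; lra.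
have /= := mass_doubling J 1 z om0 om2 c0 A1 D0 (favg_levels n) Hlev.
rewrite /incr !mul0r subr0 addr0.
have : 0 <= (if M - Lam <= z then om * s else 0).
  by case: ifP => //; rewrite mulr_ge0// ltW.
rewrite -[n.+1%:R]natr1.
(* the exact second moment of a level is at most its squared mean plus 4 ^ J *)
set q := A - D * ((z - B + J%:R / 3) ^+ 2 + 4 ^+ J).
have q1 : q <= 1.
  by apply: le_trans A1; rewrite lerBlDr lerDl mulr_ge0// addr_ge0 ?sqr_ge0 ?exprn_ge0.
have loss0 : 0 <= om * s * (1 - q + om / 2) by rewrite !mulr_ge0//; lra.
have gain0 : 0 <= (2 - om) * s * D *
    (4 / 27 * 4 ^+ J + 2 / 9 * J%:R + 23 / 27 + (J%:R / 3) ^+ 2).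
  apply: mulr_ge0; first exact: mulr_ge0.
  by rewrite !addr_ge0 ?mulr_ge0 ?sqr_ge0 ?exprn_ge0.
(* The difference of the two sides is a sum of nonnegative terms: the light
   piece, the bound for the level, the excess of the squared mean plus 4 ^ J over
   the exact second moment, and the part of the allowed loss that is not used. *)
set leaf := (if _ then _ else _); set rest := mass _ _ _; set X := (X in X <= rest).
move=> leaf0 restX; rewrite -subr_ge0 [leRHS](_ : _ = leaf / 2 + (rest - X) / 2 +
  ((2 - om) * s * D *
    (4 / 27 * 4 ^+ J + 2 / 9 * J%:R + 23 / 27 + (J%:R / 3) ^+ 2)) / 2 +
  (om * s * (1 - q + om / 2)) / 2); last by rewrite /X /q /A /B; field.
by rewrite !addr_ge0 ?divr_ge0 ?subr_ge0.
Qed.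

Lemma wge_levels n s : 0 < om -> om <= 1 / 2 -> 0 <= s -> wge (om * s) (levels n s).
Proof.
move=> om0 om2; elim: n s => [|n IHn] s s0 /=; first by rewrite ler_piMl//; lra.
split=> //; apply: wge_doubling => //.
have : 0 <= (1 / 2 - om) * s by rewrite mulr_ge0//; lra.
lra.
Qed.

Lemma A1tree_levels Q n s : 0 < Q -> om = 2 / Q -> om <= 1 / 2 -> 0 < s ->
  A1tree Q (levels n s).
Proof.
move=> Q0 omE om2; elim: n s => [|n IHn] s s0 //.
have om0 : 0 < om by rewrite omE divr_gt0.
have : 0 <= (1 / 2 - om) * s by rewrite mulr_ge0 ?(ltW s0)//; lra.
have : 0 < om * s by rewrite mulr_gt0.
move=> *; split; [by rewrite /=; lra| |].
  apply: (@A1tree_doubling _ _ _ s) => //; [exact: wavg_levels| |lra|lra].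
  by move=> *; apply: wge_levels.
apply: wge_le (wge_levels n.+1 om0 om2 (ltW s0)).
rewrite (wavg_levels n.+1) omE mulrAC ler_pM2r ?invr_gt0//; lra.
Qed.

Lemma signs_levels n s : signs_le1 (levels n s).
Proof.
elim: n s => [|n IHn] s //=; rewrite normr0; split=> //.
exact: signs_doubling.
Qed.

End Levels.
End Trees.

(** * Dyadic intervals *)

Section Dyadic.
Context {R : realType}.
Implicit Types (J K : dyadic) (t : R).
Local Notation mu := (@lebesgue_measure R).

Lemma dlen_gt0 J : 0 < dlen R J.
Proof. by rewrite exprz_gt0. Qed.

Lemma dlen_dleft J : dlen R (dleft J) = dlen R J / 2.
Proof. by rewrite /dlen /= opprD expfzDr// exprN1. Qed.

Lemma dlen_dright J : dlen R (dright J) = dlen R J / 2.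
Proof. by rewrite -dlen_dleft. Qed.

Definition mid J : R := (2 * J.2 + 1)%:~R * (dlen R J / 2).

Lemma dintP J t :
  dint R J t <-> J.2%:~R * dlen R J <= t < (J.2 + 1)%:~R * dlen R J.
Proof. by rewrite /dint /= in_itv. Qed.

Lemma dleftE J t : dint R (dleft J) t <-> dint R J t /\ t < mid J.
Proof.
rewrite !dintP dlen_dleft /= /mid.
rewrite !intrD !intrM; have := dlen_gt0 J.
split=> [/andP[? ?]|[/andP[? ?] ?]]; last by apply/andP; split; lra.
by split; [apply/andP; split|]; lra.
Qed.

Lemma drightE J t : dint R (dright J) t <-> dint R J t /\ ~ (t < mid J).
Proof.
rewrite !dintP dlen_dright /= /mid.
rewrite !intrD !intrM; have := dlen_gt0 J.
split=> [/andP[? ?]|[/andP[? ?] /negP ?]]; last by apply/andP; split; lra.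
by split; [apply/andP; split|apply/negP]; lra.
Qed.

Lemma dint_split J : dint R J = dint R (dleft J) `|` dint R (dright J).
Proof.
apply/seteqP; split=> t; last by case=> [/dleftE|/drightE] [].
move=> Jt; have [tm|tm] := boolP (t < mid J); first by left; apply/dleftE.
by right; apply/drightE; split=> //; apply/negP.
Qed.

Lemma dleft_right J : [disjoint dint R (dleft J) & dint R (dright J)].
Proof.
by apply/eqP/seteqP; split=> // t [/dleftE[_ tm] /drightE[_]].
Qed.

Lemma dleft_sub J : dint R (dleft J) `<=` dint R J.
Proof. by move=> t /dleftE[]. Qed.

Lemma dright_sub J : dint R (dright J) `<=` dint R J.
Proof. by move=> t /drightE[]. Qed.

(** In units of the length of the finer interval [K] all end points are integers,
    and no integer lies strictly between the end points of [K]. *)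
Lemma dint_nested J K : J.1 <= K.1 ->
  dint R K `<=` dint R J \/ dint R K `&` dint R J = set0.
Proof.
move=> JK; set p := `|K.1 - J.1|%N.
have pE : K.1 = J.1 + p by rewrite /p gez0_abs ?subr_ge0// (addrC J.1) subrK.
have d0 := dlen_gt0 K.
have dE : dlen R J = (2 ^+ p : int)%:~R * dlen R K.
  rewrite /dlen pE opprD expfzDr// mulrCA rmorphXn /= -(invr_expz _ p).
  by rewrite -exprnP mulfV ?mulr1// expf_neq0.
have lo : ((J.2 * 2 ^+ p)%:~R * dlen R K : R) = J.2%:~R * dlen R J by rewrite dE intrM mulrA.
have hi : (((J.2 + 1) * 2 ^+ p)%:~R * dlen R K : R) = (J.2 + 1)%:~R * dlen R J.
  by rewrite dE intrM mulrA.
have [inJ|outJ] := boolP ((J.2 * 2 ^+ p <= K.2) && (K.2 + 1 <= (J.2 + 1) * 2 ^+ p)).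
  left=> t /dintP/andP[Kt tK]; apply/dintP; rewrite -lo -hi.
  move/andP: inJ => [a b]; apply/andP; split.
    by apply: le_trans Kt; rewrite ler_pM2r// ler_int.
  by apply: lt_le_trans tK _; rewrite ler_pM2r// ler_int.
right; apply/seteqP; split=> // t [/dintP/andP[Kt tK] /dintP]; rewrite -lo -hi => /andP[Jt tJ].
case/negP: outJ; apply/andP; split.
  by move: (le_lt_trans Jt tK); rewrite ltr_pM2r// ltr_int ltzD1; apply.
by move: (le_lt_trans Kt tJ); rewrite ltr_pM2r// ltr_int lezD1; apply.
Qed.

Lemma dint_nonempty J : dint R J (J.2%:~R * dlen R J).
Proof. by apply/dintP; rewrite lexx ltr_pM2r ?dlen_gt0// ltr_int ltzD1 lexx. Qed.

(** This trichotomy is what makes induction over a tree reach every dyadic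
    subinterval of its root, not only the nodes. *)
Lemma dint_sub_cases J K : dint R K `<=` dint R J ->
  [\/ dint R K = dint R J, dint R K `<=` dint R (dleft J)
    | dint R K `<=` dint R (dright J)].
Proof.
move=> KJ; have [le|lt] := leP K.1 J.1.
  apply: Or31; have [JK|/seteqP[+ _]] := dint_nested le; first exact/seteqP.
  by case/(_ (K.2%:~R * dlen R K)); split; [apply: KJ|]; exact: dint_nonempty.
have : (dleft J).1 <= K.1 by rewrite /= lezD1.
case/dint_nested => [|/seteqP[+ _]]; first exact: Or32.
move=> dis; apply: Or33 => t Kt; apply/drightE; split; first exact: KJ.
by move=> tm; apply: (dis t); split=> //; apply/dleftE; split=> //; apply: KJ.
Qed.

Lemma lebesgue_dint J : mu (dint R J) = (dlen R J)%:E.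
Proof.
rewrite lebesgue_measure_itv /= lte_fin ltr_pM2r ?dlen_gt0// ltr_int ltzD1 lexx.
by rewrite -EFinB -mulrBl -intrB (addrC J.2) addrK mul1r.
Qed.

Lemma dlen_dint J K : dint R J = dint R K -> dlen R J = dlen R K.
Proof. by move=> JK; apply: EFin_inj; rewrite -!lebesgue_dint JK. Qed.

End Dyadic.

(** * Step functions of a tree *)

Section StepFunctions.
Context {R : realType}.
Implicit Types (T : tree R) (J K : dyadic) (t : R) (g : R -> R -> R).
Local Notation mu := (@lebesgue_measure R).

(** The choice between the subtrees only compares [t] with the midpoint, so that
    the function is defined, and measurable, on the whole line; only its values on
    [dint R J] matter. *)
Fixpoint stepf g T J t : R :=
  match T with
  | Leaf w f => g w f
  | Node _ l r =>
      if t < mid J then stepf g l (dleft J) t else stepf g r (dright J) t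
  end.

Fixpoint zval T J t : R :=
  match T with
  | Leaf _ _ => 0
  | Node e l r =>
      if t < mid J then zval l (dleft J) t - incr e l r
      else zval r (dright J) t + incr e l r
  end.

Lemma measurable_lt_mid (m : R) : measurable_fun setT (fun t : R => t < m).
Proof. by apply: measurable_fun_ltr => //; exact: measurable_cst. Qed.

Lemma measurable_stepf g T J : measurable_fun setT (stepf g T J).
Proof.
elim: T J => [w f|e l IHl r IHr] J; first exact: measurable_cst.
exact: measurable_fun_ifT (measurable_lt_mid _) (IHl _) (IHr _).
Qed.

Lemma measurable_zval T J : measurable_fun setT (zval T J).
Proof.
elim: T J => [w f|e l IHl r IHr] J; first exact: measurable_cst.
apply: measurable_fun_ifT (measurable_lt_mid _) _ _.
  by apply: measurable_funB => //; exact: measurable_cst.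
by apply: measurable_funD => //; exact: measurable_cst.
Qed.

Lemma stepf_left g e l r J t : dint R (dleft J) t ->
  stepf g (Node e l r) J t = stepf g l (dleft J) t.
Proof. by move=> /dleftE[_ /= ->]. Qed.

Lemma stepf_right g e l r J t : dint R (dright J) t ->
  stepf g (Node e l r) J t = stepf g r (dright J) t.
Proof. by move=> /drightE[_ /= /negP/negbTE ->]. Qed.

Lemma zval_left e l r J t : dint R (dleft J) t ->
  zval (Node e l r) J t = zval l (dleft J) t - incr e l r.
Proof. by move=> /dleftE[_ /= ->]. Qed.

Lemma zval_right e l r J t : dint R (dright J) t ->
  zval (Node e l r) J t = zval r (dright J) t + incr e l r.
Proof. by move=> /drightE[_ /= /negP/negbTE ->]. Qed.

Lemma integral_disjointU (F : R -> R) (A B : set R) :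
    measurable A -> measurable B -> measurable_fun setT F -> [disjoint A & B] ->
  (\int[mu]_(t in A `|` B) (F t)%:E =
   \int[mu]_(t in A) (F t)%:E + \int[mu]_(t in B) (F t)%:E)%E.
Proof.
move=> mA mB mF AB; apply: integral_setU => //.
exact/measurable_EFinP/measurable_funTS.
Qed.

Lemma integral_halves (F : R -> R) J : measurable_fun setT F ->
  (\int[mu]_(t in dint R J) (F t)%:E =
   \int[mu]_(t in dint R (dleft J)) (F t)%:E +
   \int[mu]_(t in dint R (dright J)) (F t)%:E)%E.
Proof.
move=> mF; rewrite {1}(dint_split J).
by apply: integral_disjointU => //; [exact: measurable_dint..|exact: dleft_right].
Qed.

Lemma integral_stepf g T J :
  (\int[mu]_(t in dint R J) (stepf g T J t)%:E = (dlen R J * avg g T)%:E)%E.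
Proof.
elim: T J => [w f|e l IHl r IHr] J.
  rewrite [LHS](integral_cst mu (measurable_dint R J) (g w f)%:E).
  rewrite [X in (_ * X)%E](lebesgue_dint J).
  by rewrite -EFinM mulrC.
rewrite integral_halves; last exact: measurable_stepf.
have -> : (\int[mu]_(t in dint R (dleft J)) (stepf g (Node e l r) J t)%:E =
           \int[mu]_(t in dint R (dleft J)) (stepf g l (dleft J) t)%:E)%E.
  by apply: eq_integral => t /set_mem ht; rewrite stepf_left.
have -> : (\int[mu]_(t in dint R (dright J)) (stepf g (Node e l r) J t)%:E =
           \int[mu]_(t in dint R (dright J)) (stepf g r (dright J) t)%:E)%E.
  by apply: eq_integral => t /set_mem ht; rewrite stepf_right.
by rewrite IHl IHr dlen_dleft dlen_dright -EFinD /=; congr EFin; field.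
Qed.

Lemma stepf_bounded g T : exists B : R, forall J t, `|stepf g T J t| <= B.
Proof.
elim: T => [w f|e l [Bl hl] r [Br hr]]; first by exists `|g w f|.
by exists (Num.max Bl Br) => J t /=; case: ifP => _; rewrite le_max ?hl ?hr ?orbT.
Qed.

(** The combinatorial [mass] is the true weight of a superlevel set. The statement
    has a free starting value [z] because this value changes along the tree. *)
Lemma integral_mass lam T J z :
  (\int[mu]_(t in [set t | dint R J t /\ (lam <= z + zval T J t)%R])
     (stepf (fun w _ => w) T J t)%:E = (dlen R J * mass lam T z)%:E)%E.
Proof.
elim: T J z => [w f|e l IHl r IHr] J z.
  rewrite /= addr0; case: ifPn => [lz|nlz].
    rewrite (_ : [set t | _ ] = dint R J).
      exact: (integral_stepf (fun w _ => w) (Leaf w f)).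
    by apply/seteqP; split=> t // [].
  rewrite (_ : [set t | _ ] = set0) ?integral_set0 ?mulr0//.
  by apply/seteqP; split=> t // [_] /=.
pose half T' K z' := [set t | dint R K t /\ lam <= z' + zval T' K t].
have mhalf T' K z' : measurable (half T' K z').
  apply: measurable_fun_le; [exact: measurable_dint|exact: measurable_cst|].
  apply: measurable_funD; first exact: measurable_cst.
  exact: measurable_funTS (measurable_zval _ _).
have half_sub T' K z' : half T' K z' `<=` dint R K by move=> t [].
rewrite (_ : [set t | _] = half l (dleft J) (z - incr e l r) `|`
                           half r (dright J) (z + incr e l r)%R); last first.
  apply/seteqP; split=> t.
    rewrite /half /=; case; rewrite {1}dint_split => -[] h; [left|right]; split=> //.
      by move: (zval_left e l r h) b => /= ->; rewrite addrAC addrA.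
    by move: (zval_right e l r h) b => /= ->; rewrite addrAC addrA.
  case=> -[h lz]; split; first exact: dleft_sub.
  - by rewrite zval_left// addrA addrAC.
  - exact: dright_sub.
  - by rewrite zval_right// addrA addrAC.
rewrite integral_disjointU//; last first.
- apply/eqP; rewrite -subset0 => t [/half_sub ht /half_sub ht'].
  by have /eqP := dleft_right (R := R) J; rewrite -subset0; apply; split; [exact: ht|].
- exact: measurable_stepf.
set w := fun w _ : R => w.
have -> : (\int[mu]_(t in half l (dleft J) (z - incr e l r)%R) (stepf w (Node e l r) J t)%:E =
    \int[mu]_(t in half l (dleft J) (z - incr e l r)%R) (stepf w l (dleft J) t)%:E)%E.
  by apply: eq_integral => t /set_mem /half_sub ht; rewrite stepf_left.
have -> : (\int[mu]_(t in half r (dright J) (z + incr e l r)%R) (stepf w (Node e l r) J t)%:E =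
    \int[mu]_(t in half r (dright J) (z + incr e l r)%R) (stepf w r (dright J) t)%:E)%E.
  by apply: eq_integral => t /set_mem /half_sub ht; rewrite stepf_right.
by rewrite IHl IHr dlen_dleft dlen_dright -EFinD /=; congr EFin; field.
Qed.

End StepFunctions.

(** * The martingale transform of a step function *)

Section Transform.
Context {R : realType}.
Implicit Types (T : tree R) (J K : dyadic) (t : R) (g : R -> R -> R).
Local Notation mu := (@lebesgue_measure R).

Definition wval : R -> R -> R := fun w _ => w.
Definition fval : R -> R -> R := fun _ f => f.

Lemma stepf_scale (a : R) T J t :
  stepf (fun _ f => a * f) T J t = a * stepf fval T J t.
Proof. by elim: T J => [//|e l IHl r IHr] J /=; case: ifP. Qed.

Lemma avg_scale (a : R) T : avg (fun _ f => a * f) T = a * favg T.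
Proof. by elim: T => [//|e l IHl r IHr] /=; rewrite IHl IHr /favg /=; field. Qed.

Lemma haar_left J t : dint R (dleft J) t -> haar J t = - (Num.sqrt (dlen R J))^-1.
Proof.
move=> ht; rewrite /haar !indicE (mem_set ht) memNset ?sub0r ?mulrN1//.
by move/drightE => -[_]; case/dleftE: ht.
Qed.

Lemma haar_right J t : dint R (dright J) t -> haar J t = (Num.sqrt (dlen R J))^-1.
Proof.
move=> ht; rewrite /haar !indicE (mem_set ht) memNset ?subr0 ?mulr1//.
by move/dleftE => -[_]; case/drightE: ht.
Qed.

Lemma haar_out J t : ~ dint R J t -> haar J t = 0.
Proof.
move=> ht; rewrite /haar !indicE !memNset ?subr0 ?mulr0//.
  by move/dleft_sub.
by move/dright_sub.
Qed.

(** On the support of the Haar function the integrand is again a step function,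
    with the test values rescaled by opposite factors on the two halves, so its
    integral is an average over trees. *)
Lemma scal_haar (phi : R -> R) e l r J :
    (forall t, dint R J t -> phi t = stepf fval (Node e l r) J t) ->
  scal phi (haar J) = (Num.sqrt (dlen R J))^-1 * (dlen R J / 2 * (favg r - favg l)).
Proof.
move=> phiE; set s := _^-1.
pose F t := if t < mid J then stepf (fun _ f => - s * f) l (dleft J) t
            else stepf (fun _ f => s * f) r (dright J) t.
have mF : measurable_fun setT F.
  exact: measurable_fun_ifT (measurable_lt_mid _) (measurable_stepf _ _ _)
    (measurable_stepf _ _ _).
have Fl t : dint R (dleft J) t -> F t = stepf (fun _ f => - s * f) l (dleft J) t.
  by move=> /dleftE[_]; rewrite /F => ->.
have Fr t : dint R (dright J) t -> F t = stepf (fun _ f => s * f) r (dright J) t.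
  by move=> /drightE[_ /negP/negbTE]; rewrite /F => ->.
have phiF : (fun t => (phi t * haar J t)%:E) = (fun t => (F t)%:E) \_ (dint R J).
  apply/funext => t; rewrite patchE; case: ifPn => [/set_mem|/negP] ht; last first.
    by rewrite haar_out ?mulr0// => h; apply: ht; rewrite inE.
  rewrite phiE//; move: ht; rewrite {1}dint_split => -[] ht.
    by rewrite haar_left// stepf_left// Fl// stepf_scale mulrC.
  by rewrite haar_right// stepf_right// Fr// stepf_scale mulrC.
rewrite /scal /Rintegral phiF -integral_mkcond integral_halves//.
have -> : (\int[mu]_(t in dint R (dleft J)) (F t)%:E = \int[mu]_(t in dint R (dleft J))
    (stepf (fun _ f => - s * f) l (dleft J) t)%:E)%E.
  by apply: eq_integral => t /set_mem /Fl ->.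
have -> : (\int[mu]_(t in dint R (dright J)) (F t)%:E = \int[mu]_(t in dint R (dright J))
    (stepf (fun _ f => s * f) r (dright J) t)%:E)%E.
  by apply: eq_integral => t /set_mem /Fr ->.
by rewrite !integral_stepf !avg_scale dlen_dleft dlen_dright /=; field.
Qed.

Lemma sqrt_dlen J (x : R) :
  (Num.sqrt (dlen R J))^-1 * (dlen R J / 2 * x) * (Num.sqrt (dlen R J))^-1 = x / 2.
Proof.
have d0 := @dlen_gt0 R J.
rewrite -{2}(sqr_sqrtr (ltW d0)).
have : Num.sqrt (dlen R J) != 0 by rewrite sqrtr_eq0 -ltNge.
by move=> ?; field.
Qed.

Fixpoint nodes T J : seq dyadic :=
  match T with
  | Leaf _ _ => [::]
  | Node _ l r => J :: nodes l (dleft J) ++ nodes r (dright J)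
  end.

Fixpoint sign T J K : R :=
  match T with
  | Leaf _ _ => 0
  | Node e l r =>
      if K == J then e
      else if K \in nodes l (dleft J) then sign l (dleft J) K
      else sign r (dright J) K
  end.

Lemma nodes_sub T J K : K \in nodes T J -> dint R K `<=` dint R J.
Proof.
elim: T J => [//|e l IHl r IHr] J /=; rewrite inE mem_cat => /orP[/eqP -> //|].
move=> /orP[/IHl|/IHr] KJ t /KJ; [exact: dleft_sub|exact: dright_sub].
Qed.

Lemma nodes_depth T J K : K \in nodes T J -> J.1 <= K.1.
Proof.
elim: T J => [//|e l IHl r IHr] J /=; rewrite inE mem_cat => /orP[/eqP -> //|].
by move=> /orP[/IHl|/IHr] /=; apply: le_trans; rewrite lerDl.
Qed.

Lemma nodes_disjoint l r J K : K \in nodes r (dright J) -> K \notin nodes l (dleft J).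
Proof.
move=> /nodes_sub Kr; apply/negP => /nodes_sub Kl.
have := dint_nonempty (R := R) K => h.
by case/drightE: (Kr _ h) => _; case/dleftE: (Kl _ h).
Qed.

Lemma nodes_child_neq l r J K :
  K \in nodes l (dleft J) ++ nodes r (dright J) -> K != J.
Proof.
rewrite mem_cat => h; apply/eqP => KJ; subst K.
by move: h => /orP[] /nodes_depth /=; rewrite gerDl.
Qed.

Lemma nodes_uniq T J : uniq (nodes T J).
Proof.
elim: T J => [//|e l IHl r IHr] J /=; rewrite cat_uniq IHl IHr andbT /=.
apply/andP; split; first by apply/negP => /nodes_child_neq/eqP.
by apply/hasPn => K; exact: nodes_disjoint.
Qed.

Lemma sign_support T J K : sign T J K != 0 -> K \in nodes T J.
Proof.
elim: T J => [|e l IHl r IHr] J /=; first by rewrite eqxx.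
rewrite inE mem_cat; case: (eqVneq K J) => //= _.
by case: (boolP (K \in nodes l _)) => //= _; exact: IHr.
Qed.

Lemma sign_admissible T J : signs_le1 T -> admissible (sign T J).
Proof.
move=> sT; split.
  by apply: (@sub_finite_set _ _ [set` nodes T J]) => [K|]; [exact: sign_support|exact: finite_seq].
move=> K; elim: T J sT => [|e l IHl r IHr] J /=; first by rewrite normr0.
by case=> e1 /IHl ? /IHr ?; case: ifP => // _; case: ifP.
Qed.

(** At a given point only the nodes above it contribute, and each contributes the
    increment of [zval]: the normalizations of the two Haar factors cancel the
    length of the interval. *)
Lemma sum_nodes (phi : R -> R) T J t :
    (forall t, dint R J t -> phi t = stepf fval T J t) -> dint R J t ->
  \sum_(K <- nodes T J) sign T J K * scal phi (haar K) * haar K t = zval T J t.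
Proof.
elim: T J => [|e l IHl r IHr] J phiE Jt; first by rewrite big_nil.
rewrite [nodes _ _]/= big_cons big_cat.
have -> : \sum_(K <- nodes l (dleft J)) sign (Node e l r) J K * scal phi (haar K) * haar K t
    = \sum_(K <- nodes l (dleft J)) sign l (dleft J) K * scal phi (haar K) * haar K t.
  apply: eq_big_seq => K hK; rewrite /= hK ifN//.
  by apply: (@nodes_child_neq l r); rewrite mem_cat hK.
have -> : \sum_(K <- nodes r (dright J)) sign (Node e l r) J K * scal phi (haar K) * haar K t
    = \sum_(K <- nodes r (dright J)) sign r (dright J) K * scal phi (haar K) * haar K t.
  apply: eq_big_seq => K hK; rewrite /= (negbTE (nodes_disjoint l hK)) ifN//.
  by apply: (@nodes_child_neq l r); rewrite mem_cat hK orbT.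
have outside T' J' : ~ dint R J' t ->
    \sum_(K <- nodes T' J') sign T' J' K * scal phi (haar K) * haar K t = 0.
  move=> out; apply: big1_seq => K /andP[_ /nodes_sub KJ].
  by rewrite haar_out ?mulr0// => /KJ.
rewrite (scal_haar phiE) /= eqxx; move: Jt; rewrite {1}dint_split => -[] Jt.
  have [_ tm] := (dleftE J t).1 Jt.
  rewrite tm IHl//; last by move=> u Ju; rewrite phiE ?stepf_left//; exact: dleft_sub.
  rewrite outside ?addr0; last by case/drightE.
  by rewrite haar_left// mulrN -[e * _ * _]mulrA sqrt_dlen addrC.
have [_ /negP/negbTE tm] := (drightE J t).1 Jt.
rewrite tm IHr//; last by move=> u Ju; rewrite phiE ?stepf_right//; exact: dright_sub.
rewrite outside ?add0r; last by case/dleftE => _; rewrite tm.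
by rewrite haar_right// -[e * _ * _]mulrA sqrt_dlen addrC.
Qed.

Lemma transform_tree (phi : R -> R) T J t :
    (forall t, dint R J t -> phi t = stepf fval T J t) -> dint R J t ->
  martingale_transform (sign T J) J phi t = zval T J t.
Proof.
move=> phiE Jt; rewrite /martingale_transform (fsbigE (nodes T J)).
- rewrite -(sum_nodes phiE Jt) big_seq_cond [RHS]big_seq_cond; apply: eq_bigl => K.
  by case: (boolP (K \in nodes T J)) => //= /nodes_sub h; rewrite mem_set.
- exact: nodes_uniq.
- by move=> K /= /nodes_sub.
- move=> K _ KT; have [->|/sign_support] := eqVneq (sign T J K) 0; first by rewrite !mul0r.
  by rewrite (negbTE KT).
Qed.

End Transform.

(** * From A1 trees to A1 weights on the line *)

Section Weight.
Context {R : realType}.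
Implicit Types (T : tree R) (J K : dyadic) (t Q : R).
Local Notation mu := (@lebesgue_measure R).

Lemma wge_stepf (c : R) T J t : wge c T -> c <= stepf wval T J t.
Proof. by elim: T J => [//|e l IHl r IHr] J /= [/IHl ? /IHr ?]; case: ifP. Qed.

Lemma wavg_gt0 Q T : A1tree Q T -> 0 < wavg T.
Proof.
by elim: T => [//|e l IHl r IHr] /= [/IHl l0 /IHr r0 _]; rewrite /wavg /= divr_gt0// addr_gt0.
Qed.

(** A witness [m] for the essential infimum is used instead of the infimum itself:
    it is enough for an upper bound of the ratio, and it passes to restrictions. *)
Definition A1on Q (w : R -> R) K : Prop :=
  exists a m : R, [/\ 0 < m, a <= Q * m,
    (\int[mu]_(t in dint R K) (w t)%:E = (dlen R K * a)%:E)%E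
    & forall t, dint R K t -> m <= w t].

Lemma eq_A1on Q (w w' : R -> R) K : (forall t, dint R K t -> w t = w' t) ->
  A1on Q w K -> A1on Q w' K.
Proof.
move=> ww' [a [m [m0 am int mw]]]; exists a, m; split=> //.
  by rewrite -int; apply: eq_integral => t /set_mem /ww' ->.
by move=> t Kt; rewrite -ww'// mw.
Qed.

Lemma A1on_cst Q (v : R) K : 1 <= Q -> 0 < v -> A1on Q (fun=> v) K.
Proof.
move=> Q1 v0; exists v, v; split=> //; first by rewrite ler_peMl// ltW.
exact: (integral_stepf wval (Leaf v 0)).
Qed.

Lemma A1on_stepf Q T J K : 1 <= Q -> A1tree Q T -> dint R K `<=` dint R J ->
  A1on Q (stepf wval T J) K.
Proof.
move=> Q1; elim: T J => [w f|e l IHl r IHr] J TA KJ.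
  by apply: A1on_cst.
have [KJE|Kl|Kr] := dint_sub_cases KJ.
- have [_ _ wT] := TA; have T0 := wavg_gt0 TA; have Q0 : 0 < Q by lra.
  exists (wavg (Node e l r)), (wavg (Node e l r) / Q); split.
  + by rewrite divr_gt0.
  + by rewrite mulrC divfK// gt_eqF.
  + by rewrite (dlen_dint KJE) KJE integral_stepf.
  + by move=> t _; apply: wge_stepf.
- apply: eq_A1on (IHl _ _ Kl); last by case: TA.
  by move=> t /Kl Jt; rewrite stepf_left.
- apply: eq_A1on (IHr _ _ Kr); last by case: TA.
  by move=> t /Kr Jt; rewrite stepf_right.
Qed.

Lemma mean_integral (w : R -> R) K (a : R) :
    (\int[mu]_(t in dint R K) (w t)%:E = (dlen R K * a)%:E)%E ->
  mean K w = a%:E.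
Proof.
by rewrite /mean => ->; rewrite -EFinM mulKf// gt_eqF// dlen_gt0.
Qed.

Lemma le_einf (m : R) (w : R -> R) K : (forall t, dint R K t -> m <= w t) ->
  (m%:E <= einf K w)%E.
Proof.
move=> mw; apply/ess_infP.
exists (~` dint R K); split.
- by apply: measurableC; exact: (measurable_dint R K).
- by rewrite /= /mrestr setICl (measure0 mu).
- by move=> t /= h Kt; apply: h; rewrite lee_fin mw.
Qed.

Lemma einf_le (c : R) (w : R -> R) K K' : dint R K' `<=` dint R K ->
  (forall t, dint R K' t -> w t <= c) -> (einf K w <= c%:E)%E.
Proof.
move=> K'K wc; rewrite leNgt; apply/negP => cinf.
have [A [mA A0 sub]] := ess_inf_le (mrestr mu (measurable_dint R K)) (EFin \o w).
have K'A : dint R K' `<=` A `&` dint R K.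
  move=> t K't; split; last exact: K'K.
  apply: sub => /= h; have := lt_le_trans cinf h.
  by rewrite lte_fin ltNge wc.
have : (mu (dint R K') <= 0)%E.
  have <- : mu (A `&` dint R K) = 0%E by exact: A0.
  apply: le_measure => //; rewrite inE; first exact: measurable_dint.
  by apply: measurableI => //; exact: measurable_dint.
by rewrite lebesgue_dint lee_fin leNgt dlen_gt0.
Qed.

Lemma ratio_A1on Q (w : R -> R) K : 0 <= Q -> A1on Q w K -> (mean K w / einf K w <= Q%:E)%E.
Proof.
move=> Q0 [a [m [m0 am /mean_integral -> /le_einf]]].
case: (einf K w) => [r| |] //=.
  rewrite lee_fin => mr; rewrite inver gt_eqF ?(lt_le_trans m0)// -EFinM lee_fin.
  by rewrite ler_pdivrMr ?(lt_le_trans m0)// (le_trans am)// ler_wpM2l.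
by rewrite invey mule0 lee_fin.
Qed.

(** The interval [K] with mean [Q] makes the constant attained: its essential
    infimum is at most 1 because the weight is at most 1 on the smaller interval
    [K'], which has positive measure. *)
Lemma A1const_eq Q (w : R -> R) K K' : 0 < Q ->
    (forall J, A1on Q w J) ->
    (\int[mu]_(t in dint R K) (w t)%:E = (dlen R K * Q)%:E)%E ->
    dint R K' `<=` dint R K -> (forall t, dint R K' t -> w t <= 1) ->
  A1const w = Q%:E.
Proof.
move=> Q0 wA intK K'K w1; apply/eqP; rewrite eq_le; apply/andP; split.
  by apply: ub_ereal_sup => _ [J _ <-]; apply: ratio_A1on => //; exact: ltW.
apply: le_trans (ereal_sup_ubound _); last by exists K.
rewrite (mean_integral intK).
have [a [m [m0 _ _ /le_einf]]] := wA K.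
have := einf_le K'K w1; case: (einf K w) => [r| |] //=.
rewrite !lee_fin => r1 mr; have r0 := lt_le_trans m0 mr.
rewrite inver gt_eqF// -EFinM lee_fin ler_pdivlMr// ler_piMr// ltW//.
Qed.

Lemma stepf_cost T J t :
  stepf (fun w f => `|f| * w) T J t = `|stepf fval T J t| * stepf wval T J t.
Proof. by elim: T J => [//|e l IHl r IHr] J /=; case: ifP. Qed.

Lemma integrable_bounded (f : R -> R) (A : set R) (B : R) :
    measurable A -> (mu A < +oo)%E -> measurable_fun setT f ->
    (forall t, `|f t| <= B) -> mu.-integrable A (EFin \o f).
Proof.
move=> mA Afin mf fB; apply: measurable_bounded_integrable => //.
  exact: measurable_funTS.
exists B; split; first exact: num_real.
by move=> x Bx t _ /=; rewrite (le_trans (fB t))// ltW.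
Qed.

(** The weak type inequality, tested on the root of a tree with the step function
    of its test values and the signs that it prescribes, becomes an inequality
    between numbers computed by recursion. *)
Lemma weak_type_tree (w : R -> R) (C lam : R) T J :
    signs_le1 T -> (forall t, dint R J t -> w t = stepf wval T J t) ->
    measurable_fun setT w -> 0 < lam -> weak_type_bound w C ->
  mass lam T 0 <= C * (cost T / lam).
Proof.
move=> sT wE mw lam0 wC.
pose phi t := \1_(dint R J) t * stepf fval T J t.
have phiE t : dint R J t -> phi t = stepf fval T J t.
  by move=> Jt; rewrite /phi indicE mem_set// mul1r.
have mphi : measurable_fun setT phi.
  apply: measurable_funM; last exact: measurable_stepf.
  by apply: measurable_indic; exact: (measurable_dint R J).
have d0 := @dlen_gt0 R J.
have phiL : L1supp w J phi.
  split=> //; last by move=> t Jt; rewrite /phi indicE memNset// mul0r.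
  have [Bf hBf] := stepf_bounded fval T; have [Bw hBw] := stepf_bounded wval T.
  have : mu.-integrable (dint R J)
      (EFin \o (fun t => stepf fval T J t * stepf wval T J t)).
    apply: (@integrable_bounded _ _ (Bf * Bw)); first exact: (measurable_dint R J).
    - by rewrite [ltLHS](lebesgue_dint J) ltry.
    - by apply: measurable_funM; exact: measurable_stepf.
    - by move=> t; rewrite normrM ler_pM.
  apply: eq_integrable; first exact: (measurable_dint R J).
  by move=> t /set_mem Jt /=; rewrite phiE// wE.
have := wC J lam phi lam0 phiL.
have -> : mean J (fun t => `|phi t| * w t) = (cost T)%:E.
  apply: mean_integral; rewrite -integral_stepf; apply: eq_integral => t /set_mem Jt.
  by rewrite stepf_cost phiE// wE.
have massE : wmeas w [set t | dint R J t /\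
    lam <= martingale_transform (sign T J) J phi t] = (dlen R J * mass lam T 0)%:E.
  rewrite -integral_mass /wmeas.
  have -> : [set t | dint R J t /\ lam <= martingale_transform (sign T J) J phi t] =
            [set t | dint R J t /\ lam <= 0 + zval T J t].
    by apply/seteqP; split=> t [Jt]; rewrite /= (transform_tree phiE Jt) add0r.
  by apply: eq_integral => t /set_mem [Jt _]; rewrite wE.
rewrite inver gt_eqF// -!EFinM -lee_fin => bound; apply: le_trans bound.
rewrite -[X in (X <= _)%E](_ : (dlen R J)^-1%:E * (dlen R J * mass lam T 0)%:E = _)%E.
  rewrite lee_pmul2l ?lte_fin ?invr_gt0// -massE.
  by apply: ereal_sup_ubound; exists (sign T J) => //; exact: sign_admissible.
by rewrite -EFinM mulKf// gt_eqF.
Qed.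

Definition unitI : dyadic := (0, 0).

Lemma unitIE t : dint R unitI t <-> (0 <= t) && (t < 1).
Proof. by rewrite dintP /dlen /= oppr0 expr0z mul0r mul1r. Qed.

(** Off the unit interval the weight equals its mean over that interval; then every
    larger dyadic interval has the same mean, and the same infimum, as the unit
    interval. *)
Definition extend T t : R :=
  if (0 <= t) && (t < 1) then stepf wval T unitI t else wavg T.

Lemma measurable_extend T : measurable_fun setT (extend T).
Proof.
apply: measurable_fun_ifT => //; last exact: measurable_stepf.
apply: measurable_and.
  by apply: measurable_fun_ler => //; exact: measurable_cst.
by apply: measurable_fun_ltr => //; exact: measurable_cst.
Qed.

Lemma extend_in T t : dint R unitI t -> extend T t = stepf wval T unitI t.
Proof. by move=> /unitIE; rewrite /extend => ->. Qed.

Lemma extend_out T t : ~ dint R unitI t -> extend T t = wavg T.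
Proof. by rewrite /extend; case: ifP => // /unitIE. Qed.

Lemma A1on_extend Q T K : 1 <= Q -> A1tree Q T -> wge (wavg T / Q) T ->
  A1on Q (extend T) K.
Proof.
move=> Q1 TA wT; have T0 := wavg_gt0 TA.
have [le|/ltW gt] := leP unitI.1 K.1.
  have [KI|KI] := dint_nested (R := R) le.
    by apply: eq_A1on (A1on_stepf Q1 TA KI) => t /KI It; rewrite extend_in.
  apply: eq_A1on (A1on_cst K Q1 T0) => t Kt; rewrite extend_out// => It.
  by have /seteqP[/(_ t) h _] := KI; apply: h.
have [IK|IK] := dint_nested (R := R) gt; last first.
  apply: eq_A1on (A1on_cst K Q1 T0) => t Kt; rewrite extend_out// => It.
  by have /seteqP[/(_ t) h _] := IK; apply: h.
exists (wavg T), (wavg T / Q); have Q0 : 0 < Q by lra.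
split; [by rewrite divr_gt0|by rewrite mulrC divfK// gt_eqF| |]; last first.
  move=> t _; rewrite /extend; case: ifP => _; first exact: wge_stepf.
  by rewrite ler_pdivrMr// ler_peMr// ltW.
have dI := measurable_dint R unitI; have dK := measurable_dint R K.
have split_int (F : R -> R) : measurable_fun setT F ->
    (\int[mu]_(t in dint R K) (F t)%:E = \int[mu]_(t in dint R unitI) (F t)%:E +
       \int[mu]_(t in dint R K `\` dint R unitI) (F t)%:E)%E.
  move=> mF; rewrite -{1}(setDUK IK) integral_disjointU//; first exact: measurableD.
  by apply/eqP; rewrite setDE setICA setICr setI0.
rewrite split_int; last exact: measurable_extend.
have /= <- := integral_stepf wval (Leaf (wavg T) 0) K.
rewrite split_int; last exact: measurable_cst.
congr (_ + _)%E.
  rewrite [RHS](integral_stepf wval (Leaf (wavg T) 0)) /= /wavg -(integral_stepf wval T).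
  by apply: eq_integral => t /set_mem It; rewrite extend_in.
by apply: eq_integral => t /set_mem [_ It]; rewrite extend_out.
Qed.

(** The tree is placed on the left half of the unit interval. The right half only
    serves to make the A1 constant equal to [Q] rather than at most [Q]: there the
    weight takes the values 1 and [2 * Q - 1]. *)
Lemma A1tree_realized Q T : 1 <= Q ->
    A1tree Q T -> signs_le1 T -> wge 1 T -> wavg T <= Q ->
  exists w : R -> R, [/\ A1 w, A1const w = Q%:E
    & forall C lam : R, 0 < lam -> weak_type_bound w C ->
        mass lam T 0 <= C * (cost T / lam)].
Proof.
move=> Q1 TA sT T1 TQ; have Q0 : 0 < Q by lra.
pose S : tree R := Node 0 (Leaf 1 0) (Leaf (2 * Q - 1) 0).
have SE : wavg S = Q by rewrite /wavg /=; field.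
have S1 : wge 1 S by split=> //=; lra.
have SA : A1tree Q S.
  by split; [exact: ltr01|rewrite /=; lra|rewrite SE divff ?gt_eqF].
pose U := Node 0 T S.
have UE : wavg U <= Q by rewrite (_ : wavg U = (wavg T + wavg S) / 2)// SE; lra.
have wU : wge (wavg U / Q) U.
  apply: (@wge_le _ _ 1 U); last exact: (conj T1 S1).
  by rewrite ler_pdivrMr// mul1r.
have UA : A1tree Q U by split.
have AU K : A1on Q (extend U) K by apply: A1on_extend.
have right_sub : dint R (dright unitI) `<=` dint R unitI by exact: dright_sub.
have UC : A1const (extend U) = Q%:E.
  apply: (@A1const_eq _ _ (dright unitI) (dleft (dright unitI))) => //.
  - rewrite -[in RHS]SE -integral_stepf; apply: eq_integral => t /set_mem It.
    by rewrite extend_in; [rewrite [stepf _ U _ _]stepf_right|exact: right_sub].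
  - exact: dleft_sub.
  - move=> t It; have It' := dleft_sub It.
    rewrite extend_in; last exact: right_sub.
    by rewrite [stepf _ U _ _]stepf_right// stepf_left.
have mU := measurable_extend U.
exists (extend U); split=> //.
- split; last by rewrite UC ltry.
  split.
    move=> t; rewrite /extend; case: ifP => _; last exact: wavg_gt0 UA.
    by apply: lt_le_trans (wge_stepf _ _ _); [exact: ltr01|split].
  split=> //; first exact: openT.
  move=> K _ cK; have [B hB] := stepf_bounded wval U.
  have /integrableP[] // : mu.-integrable K (EFin \o extend U).
  apply: (@integrable_bounded _ _ (Num.max B `|wavg U|)) => //.
  - exact: compact_measurable.
  - exact: compact_finite_measure.
  - by move=> t; rewrite /extend le_max; case: ifP => _; rewrite ?hB ?lexx ?orbT.
- move=> C lam lam0; apply: (@weak_type_tree _ _ _ _ (dleft unitI)) => // t It.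
  by rewrite extend_in; [rewrite [stepf _ U _ _]stepf_left|exact: dleft_sub].
Qed.

End Weight.

(** * Choice of the parameters *)

Section Constants.
Context {R : realType}.
Implicit Types (C Q : R) (N J : nat).

Lemma cost_ge0 (T : tree R) : wge 0 T -> 0 <= cost T.
Proof.
elim: T => [w f|e l IHl r IHr] /=; first by move=> w0; rewrite /cost /= mulr_ge0.
by case=> /IHl l0 /IHr r0; rewrite /cost /= divr_ge0// addr_ge0.
Qed.

(** The test function lives on the light half, and a single Haar term moves it to
    the heavy half. This settles the small values of [Q], for which the
    logarithmic factor is bounded. *)
Lemma weight_of_two_halves Q : 1 <= Q ->
  exists w : R -> R, [/\ A1 w, A1const w = Q%:E
    & forall C, weak_type_bound w C -> Q - 1 / 2 <= C].
Proof.
move=> Q1; pose T : tree R := Node (-1) (Leaf 1 1) (Leaf (2 * Q - 1) 0).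
have TQ : wavg T = Q by rewrite /wavg /=; field.
have T1 : wge 1 T by split=> //=; lra.
have TA : A1tree Q T.
  by split; [exact: ltr01|rewrite /=; lra|rewrite TQ divff// gt_eqF//; lra].
have sT : signs_le1 T by split=> //; rewrite normrN normr1.
have TQle : wavg T <= Q by rewrite TQ.
have [w [wA wQ wC]] := A1tree_realized Q1 TA sT T1 TQle.
exists w; split=> // C /(wC C (1 / 2)); rewrite /mass /cost /incr /favg /= => h.
have := h ltac:(lra); rewrite normr1 normr0 ifF; last by apply/negbTE; rewrite -ltNge; lra.
rewrite ifT; lra.
Qed.

(** With [om = 2 / Q], as small as the A1 condition allows, [N] of order [Q]
    levels lose only a fraction of the weight, and the total cost of the light
    pieces remains comparable to that of the final leaves. The transform then
    reaches a value of order [N * J] on half of the weight; its standard deviation,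
    at most [sqrt (N * 4 ^ J)], is small compared with that as soon as [4 ^ J <= N]
    and [J] is not too small. *)
Lemma weight_of_levels Q N J :
    (12 <= J)%N -> (4 ^+ J : R) <= N%:R -> 8 * N%:R <= Q ->
  exists w : R -> R, [/\ A1 w, A1const w = Q%:E
    & forall C, weak_type_bound w C -> 2 / 33 * (N%:R * J%:R) <= C].
Proof.
move=> J12 JN NQ.
have J12' : 12 <= J%:R :> R by rewrite ler_nat.
have N1 : 1 <= N%:R :> R by apply: le_trans JN; rewrite exprn_ege1//; lra.
have Q8 : 8 <= Q by lra.
have Q0 : 0 < Q by lra.
pose om : R := 2 / Q.
have om0 : 0 < om by rewrite divr_gt0.
have omQ : om * Q = 2 by rewrite /om divfK// gt_eqF.
have om2 : om <= 1 / 2 by rewrite /om ler_pdivrMr//; lra.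
have s0 : 0 < Q / 2 by rewrite divr_gt0.
have omN : om * N%:R <= 1 / 4.
  by rewrite /om mulrAC ler_pdivrMr//; lra.
pose T := levels om J N (Q / 2).
have T1 : wge 1 T.
  by have := wge_levels J N om0 om2 (ltW s0); rewrite mulrA omQ divff.
have TA : A1tree Q T by apply: A1tree_levels.
have sT : signs_le1 T by exact: signs_levels.
have TQle : wavg T <= Q by rewrite wavg_levels; lra.
have Q1 : 1 <= Q by lra.
have [w [wA wQ wC]] := A1tree_realized Q1 TA sT T1 TQle.
exists w; split=> // C wbound.
pose L : R := N%:R * J%:R / 6.
(* The threshold L is half of the mean 2 * L of the transform. *)
have L2N : 2 * N%:R <= L.
  have : 0 <= N%:R * (J%:R - 12) :> R by rewrite mulr_ge0// subr_ge0.
  rewrite /L; lra.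
have L0 : 0 < L by lra.
have massT : Q / 2 / 2 <= mass L T 0.
  have := mass_levels J (2 * L) N 0 om0 om2 L0 (ltW s0).
  rewrite (_ : 2 * L - L = L); last by ring.
  apply: le_trans; rewrite ler_wpM2l ?(ltW s0)//.
  rewrite (_ : 0 + N%:R * (J%:R / 3) - 2 * L = 0); last by rewrite /L; field.
  rewrite expr0n add0r.
  have : N%:R * 4 ^+ J / L ^+ 2 <= 1 / 4.
    rewrite ler_pdivrMr ?exprn_gt0//.
    have : 0 <= N%:R * (N%:R - 4 ^+ J) :> R by rewrite mulr_ge0// subr_ge0.
    have : 0 <= (L - 2 * N%:R) * (L + 2 * N%:R) :> R by rewrite mulr_ge0//; lra.
    rewrite expr2; lra.
  lra.
have costT : cost T <= 11 / 8 * (Q / 2).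
  apply: le_trans (cost_levels J N om0 om2 (ltW s0)) _.
  by rewrite ler_pM2r//; lra.
have cost0 : 0 <= cost T.
  by apply: cost_ge0; apply: wge_le T1; exact: ler01.
have := le_trans massT (wC C L L0 wbound).
rewrite mulrA ler_pdivlMr// => low.
have C0 : 0 <= C.
  rewrite leNgt; apply/negP => Cneg.
  have : 0 <= - C * cost T by rewrite mulr_ge0//; lra.
  have : 0 < Q / 2 / 2 * L by rewrite mulr_gt0//; lra.
  lra.
have up : C * cost T <= C * (11 / 8 * (Q / 2)) by rewrite ler_wpM2l.
have : Q * (2 / 33 * (N%:R * J%:R)) <= Q * C by rewrite /L in low; lra.
by rewrite ler_pM2l.
Qed.

Lemma ln4_le3 : ln (4 : R) <= 3.
Proof. by rewrite (_ : 4 = 1 + 3) ?le_ln1Dx//; lra. Qed.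

(** [N] is the integer part of [Q / 8] and [J] that of the logarithm of [N] in
    base 4, so that [N * J] is of order [Q * ln Q]. *)
Lemma level_parameters Q : 16 <= Q ->
  exists N J, [/\ 8 * N%:R <= Q, Q <= 16 * N%:R,
    (4 ^+ J : R) <= N%:R & ln Q <= 3 * J%:R + 9].
Proof.
move=> Q16; have /truncn_itv/andP[] : 0 <= Q / 8 by lra.
set N := Num.trunc _; rewrite -[N.+1%:R]natr1 => NQ QN.
have N0 : (0 < N)%N by rewrite -(ltr0n R); lra.
have /andP[lo hi] := @trunc_log_bounds 4 N isT N0.
exists N, (trunc_log 4 N); split; [lra| | |].
- have : 1 <= N%:R :> R by rewrite ler1n.
  lra.
- by rewrite -natrX ler_nat.
- set J := trunc_log 4 N in hi *.
  have Q0 : 0 < Q by lra.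
  have QJ : Q <= 4 ^+ (J + 3).
    have : N.+1%:R <= 4 ^+ J.+1 :> R by rewrite -natrX ler_nat.
    rewrite -[N.+1%:R]natr1 exprS exprD => ?.
    have : 0 <= 4 ^+ J :> R by rewrite exprn_ge0.
    rewrite (_ : 4 ^+ 3 = 64 :> R); last by ring.
    lra.
  have lnQ : ln Q <= ln (4 ^+ (J + 3)) by rewrite ler_ln ?posrE ?exprn_gt0.
  apply: le_trans lnQ _; rewrite lnXn// -[ln 4 *+ _]mulr_natr.
  have : ln 4 * (J + 3)%:R <= 3 * (J + 3)%:R :> R by rewrite ler_wpM2r// ln4_le3.
  by move/le_trans; apply; rewrite natrD; lra.
Qed.

End Constants.

Theorem theorem1p1 (R : realType) (Q : R) (hQ : 4%:R <= Q) :
  exists w : R -> R,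
    [/\ A1 w, A1const w = Q%:E
      & forall C : R, weak_type_bound w C ->
          515%:R^-1 * Q * (ln Q `^ 3%:R^-1) <= C].
Proof.
(* The logarithmic factor is handled through y ^+ 3 = ln Q: for y <= 4 two halves
   suffice, and for y > 4 the bound of order Q * ln Q beats Q * y. *)
set y := ln Q `^ _.
have lnQ0 : 0 <= ln Q by rewrite ln_ge0//; lra.
have y0 : 0 <= y by exact: powR_ge0.
have y3 : y ^+ 3 = ln Q by rewrite -powR_mulrn// -powRrM mulVf// powRr1.
have [y4|y4] := leP y 4.
  have [w [wA wQ wC]] := @weight_of_two_halves R Q ltac:(lra).
  exists w; split=> // C /wC; apply: le_trans.
  have : 0 <= Q * (4 - y) by rewrite mulr_ge0//; lra.
  lra.
have ylnQ : 16 * y <= ln Q.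
  have : 0 <= (y - 4) * (y + 4) * y by rewrite !mulr_ge0//; lra.
  rewrite -y3 !exprS expr0; lra.
have Qln : ln Q + 1 <= Q.
  have : ln (1 + (Q - 1)) <= Q - 1 by rewrite le_ln1Dx//; lra.
  rewrite addrC subrK; lra.
have [N [J [NQ QN JN lnJ]]] := @level_parameters R Q ltac:(lra).
have J12 : (12 <= J)%N by rewrite -(ler_nat R); lra.
have [w [wA wQ wC]] := weight_of_levels J12 JN NQ.
exists w; split=> // C /wC; apply: le_trans.
have J4 : 4 * y <= J%:R by lra.
have : 0 <= (16 * N%:R - Q) * y by rewrite mulr_ge0//; lra.
have : 0 <= N%:R * (J%:R - 4 * y) by rewrite mulr_ge0//; lra.
have : 0 <= Q * y by rewrite mulr_ge0//; lra.
lra.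
Qed.
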